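(* Let $\gamma>0$ and $\psi\in L^2_{\mathbb{H}}(\mathbb{R})$. Then $$\mathcal{B}_{RBF}^{\gamma}[\psi](q)=\mathcal{M}^{-\gamma^2}\,\mathcal{B}_{\frac{2}{\gamma^2}}[\psi](q),\qquad\forall q\in\mathbb{H},$$ where $\mathcal{M}^{-\gamma^2}[g](q)=e^{-\frac{q^2}{\gamma^2}}g(q)$.
   Context: $\mathbb{H}$ denotes the real quaternions; the exponential of a quaternion is defined by the usual power series. $L^2_{\mathbb{H}}(\mathbb{R})$ is the space of square integrable quaternionic-valued functions on $\mathbb{R}$, with inner product $\langle\varphi,\psi\rangle=\int_{\mathbb{R}}\overline{\psi(x)}\varphi(x)dx$. For $\nu>0$ and $n\ge0$ let $$h_n^{\nu}(x)=(-1)^ne^{\frac{\nu}{2}x^2}\frac{d^n}{dx^n}\left(e^{-\nu x^2}\right),\qquad \psi_n^{\nu}=\frac{h_n^{\nu}}{\|h_n^{\nu}\|_{L^2(\mathbb{R},dx)}},\qquad \|h_n^\nu\|^2_{L^2(\mathbb{R},dx)}=2^n\nu^nn!\left(\frac{\pi}{\nu}\right)^{1/2}.$$ For $\gamma>0$, $e_{n}^{\gamma}(q)=\sqrt{\frac{2^n}{\gamma^{2n}n!}}\,q^ne^{-\frac{q^2}{\gamma^2}}$. The slice hyperholomorphic RBF-Segal-Bargmann transform is $$\mathcal{B}_{RBF}^{\gamma}[\psi](q)=\int_{\mathbb{R}}\mathcal{A}_{RBF}^{\gamma}(q,x)\psi(x)dx,\qquad \mathcal{A}_{RBF}^{\gamma}(q,x)=\sum_{n=0}^\infty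 e_n^{\gamma}(q)\psi_n^{\frac{2}{\gamma^2}}(x).$$ The quaternionic Segal-Bargmann transform with parameter $\nu>0$ is $$\mathcal{B}_{\nu}[\psi](q)=\int_{\mathbb{R}}\mathcal{A}_{SB}^{\nu}(q,x)\psi(x)dx,\qquad \mathcal{A}_{SB}^{\nu}(q,x)=\left(\frac{\nu}{\pi}\right)^{\frac14}e^{-\frac{\nu}{2}(q^2+x^2)+\nu\sqrt2\,qx}.$$ *)

(* Defs.v *)
From HB Require Import structures.
From mathcomp Require Import all_boot all_order all_algebra.
From mathcomp Require Import all_classical all_reals all_analysis.
From mathcomp Require Import ring lra.
Set Implicit Arguments.
Unset Strict Implicit.
Unset Printing Implicit Defensive.
Import Order.TTheory GRing.Theory Num.Theory.
Import numFieldNormedType.Exports.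
Local Open Scope classical_set_scope.
Local Open Scope ring_scope.

(* [Quat a b c d] is a + b i + c j + d k. *)
Record quat (R : Type) := Quat { qRe : R; qI : R; qJ : R; qK : R }.
Arguments qRe {R} _.
Arguments qI {R} _.
Arguments qJ {R} _.
Arguments qK {R} _.

Section quat_choice.
Context {R : choiceType}.

Definition quat_to_prod (q : quat R) : R * R * R * R :=
  (qRe q, qI q, qJ q, qK q).

Definition quat_of_prod (t : R * R * R * R) : quat R :=
  let: (a, b, c, d) := t in Quat a b c d.

Lemma quat_to_prodK : cancel quat_to_prod quat_of_prod.
Proof. by case. Qed.

HB.instance Definition _ := Choice.copy (quat R) (can_type quat_to_prodK).

End quat_choice.

Section quat_ring.
Context {R : realType}.
Implicit Types p q r : quat R.

Definition add_quat p q : quat R :=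
  Quat (qRe p + qRe q) (qI p + qI q) (qJ p + qJ q) (qK p + qK q).

Definition opp_quat q : quat R := Quat (- qRe q) (- qI q) (- qJ q) (- qK q).

Definition mul_quat p q : quat R :=
  Quat (qRe p * qRe q - qI p * qI q - qJ p * qJ q - qK p * qK q)
       (qRe p * qI q + qI p * qRe q + qJ p * qK q - qK p * qJ q)
       (qRe p * qJ q - qI p * qK q + qJ p * qRe q + qK p * qI q)
       (qRe p * qK q + qI p * qJ q - qJ p * qI q + qK p * qRe q).

Definition scale_quat (a : R) q : quat R :=
  Quat (a * qRe q) (a * qI q) (a * qJ q) (a * qK q).

Lemma add_quatA : associative add_quat.
Proof. by move=> p q r; rewrite /add_quat /= !addrA. Qed.

Lemma add_quatC : commutative add_quat.
Proof. by move=> p q; congr Quat; rewrite addrC. Qed.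

Lemma add0_quat : left_id (Quat 0 0 0 0) add_quat.
Proof. by case=> a b c d; rewrite /add_quat /= !add0r. Qed.

Lemma addN_quat : left_inverse (Quat 0 0 0 0) opp_quat add_quat.
Proof. by move=> q; rewrite /add_quat /= !addNr. Qed.

HB.instance Definition _ :=
  GRing.isZmodule.Build (quat R) add_quatA add_quatC add0_quat addN_quat.

Lemma mul_quatA : associative mul_quat.
Proof. by move=> p q r; rewrite /mul_quat /=; congr Quat; ring. Qed.

Lemma mul1_quat : left_id (Quat 1 0 0 0) mul_quat.
Proof. by case=> a b c d; rewrite /mul_quat /=; congr Quat; ring. Qed.

Lemma mul_quat1 : right_id (Quat 1 0 0 0) mul_quat.
Proof. by case=> a b c d; rewrite /mul_quat /=; congr Quat; ring. Qed.

Lemma mul_quatDl : left_distributive mul_quat add_quat.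
Proof. by move=> p q r; rewrite /mul_quat /add_quat /=; congr Quat; ring. Qed.

Lemma mul_quatDr : right_distributive mul_quat add_quat.
Proof. by move=> p q r; rewrite /mul_quat /add_quat /=; congr Quat; ring. Qed.

Lemma one_quat_neq0 : Quat 1 0 0 0 != 0 :> quat R.
Proof. by apply/eqP => -[] /eqP; rewrite oner_eq0. Qed.

HB.instance Definition _ := GRing.Zmodule_isNzRing.Build (quat R)
  mul_quatA mul1_quat mul_quat1 mul_quatDl mul_quatDr one_quat_neq0.

Lemma scale_quatA a b q : scale_quat a (scale_quat b q) = scale_quat (a * b) q.
Proof. by rewrite /scale_quat /= !mulrA. Qed.

Lemma scale1_quat : left_id 1 scale_quat.
Proof. by case=> a b c d; rewrite /scale_quat /= !mul1r. Qed.

Lemma scale_quatDr : right_distributive scale_quat +%R.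
Proof. by move=> a p q; rewrite /scale_quat /=; congr Quat; rewrite mulrDr. Qed.

Lemma scale_quatDl q : {morph scale_quat^~ q : a b / a + b}.
Proof. by move=> a b; rewrite /scale_quat /=; congr Quat; rewrite mulrDl. Qed.

HB.instance Definition _ := GRing.Zmodule_isLmodule.Build R (quat R)
  scale_quatA scale1_quat scale_quatDr scale_quatDl.

Lemma scale_quatAl (a : R) p q : a *: (p * q) = (a *: p) * q.
Proof. by congr Quat => /=; ring. Qed.

HB.instance Definition _ := GRing.Lmodule_isLalgebra.Build R (quat R)
  scale_quatAl.

Lemma scale_quatAr (a : R) p q : a *: (p * q) = p * (a *: q).
Proof. by congr Quat => /=; ring. Qed.

HB.instance Definition _ := GRing.Lalgebra_isAlgebra.Build R (quat R)
  scale_quatAr.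

(* The Euclidean norm, hence the usual modulus and topology of R^4. *)
Definition norm_quat q : R :=
  Num.sqrt (qRe q ^+ 2 + qI q ^+ 2 + qJ q ^+ 2 + qK q ^+ 2).

Let sumsqr_ge0 q : 0 <= qRe q ^+ 2 + qI q ^+ 2 + qJ q ^+ 2 + qK q ^+ 2.
Proof. by rewrite !addr_ge0 ?sqr_ge0. Qed.

Lemma ler_norm_quatD p q : norm_quat (p + q) <= norm_quat p + norm_quat q.
Proof.
have nn r : 0 <= norm_quat r by exact: sqrtr_ge0.
have nE r : norm_quat r ^+ 2 = qRe r ^+ 2 + qI r ^+ 2 + qJ r ^+ 2 + qK r ^+ 2.
  exact/sqr_sqrtr/sumsqr_ge0.
rewrite -(@ler_pXn2r _ 2) ?nnegrE ?addr_ge0// sqrrD !nE.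
set s := qRe p * qRe q + qI p * qI q + qJ p * qJ q + qK p * qK q.
suff : s <= norm_quat p * norm_quat q.
  rewrite /s mulr2n /=; lra.
apply: le_trans (ler_norm _) _.
rewrite -(@ler_pXn2r _ 2) ?nnegrE ?mulr_ge0// real_normK ?num_real//.
rewrite exprMn !nE -subr_ge0 /s.
case: p q {s} => a b c d [a' b' c' d'] /=.
have -> : (a ^+ 2 + b ^+ 2 + c ^+ 2 + d ^+ 2) *
          (a' ^+ 2 + b' ^+ 2 + c' ^+ 2 + d' ^+ 2) -
          (a * a' + b * b' + c * c' + d * d') ^+ 2 =
  (a * b' - b * a') ^+ 2 + (a * c' - c * a') ^+ 2 + (a * d' - d * a') ^+ 2 +
  (b * c' - c * b') ^+ 2 + (b * d' - d * b') ^+ 2 + (c * d' - d * c') ^+ 2.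
  by ring.
by rewrite !addr_ge0 ?sqr_ge0.
Qed.

Lemma norm_quatZ (a : R) q : norm_quat (a *: q) = `|a| * norm_quat q.
Proof.
rewrite /norm_quat /= !exprMn -!mulrDr sqrtrM ?sqr_ge0//.
by rewrite sqrtr_sqr.
Qed.

Lemma norm_quat0_eq0 q : norm_quat q = 0 -> q = 0.
Proof.
case: q => a b c d /eqP; rewrite /norm_quat sqrtr_eq0 /= => h.
have : a ^+ 2 + b ^+ 2 + c ^+ 2 + d ^+ 2 == 0.
  by rewrite eq_le h !addr_ge0 ?sqr_ge0.
rewrite !paddr_eq0 ?addr_ge0 ?sqr_ge0// !sqrf_eq0.
by move=> /andP[/andP[/andP[/eqP-> /eqP->] /eqP->] /eqP->].
Qed.

HB.instance Definition _ :=
  Lmodule_isNormed.Build R (quat R) ler_norm_quatD norm_quatZ norm_quat0_eq0.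

End quat_ring.

Section transforms.
Context {R : realType}.
Implicit Types (gamma nu x : R) (q : quat R) (psi : R -> quat R) (n : nat).

Local Notation mu := (@lebesgue_measure R).

Definition exp_quat q : quat R := limn (series (fun n => n`!%:R^-1 *: q ^+ n)).

Definition measurable_quat psi : Prop :=
  [/\ measurable_fun [set: R] (qRe \o psi), measurable_fun [set: R] (qI \o psi),
      measurable_fun [set: R] (qJ \o psi) &
      measurable_fun [set: R] (qK \o psi)].

Definition L2quat psi : Prop :=
  measurable_quat psi /\ (\int[mu]_x (`|psi x| ^+ 2)%:E < +oo)%E.

Definition qintegral psi : quat R :=
  Quat (\int[mu]_x qRe (psi x)) (\int[mu]_x qI (psi x))
       (\int[mu]_x qJ (psi x)) (\int[mu]_x qK (psi x)).

(* Hermite function (not polynomial): the weight is e^(nu x^2 / 2). *)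
Definition hermite_fun nu n x : R :=
  (-1) ^+ n * expR (nu / 2 * x ^+ 2) *
  derive1n n (fun y : R => expR (- (nu * y ^+ 2))) x.

Definition normalized_hermite nu n x : R :=
  hermite_fun nu n x / fine ('N[mu]_2%:E [EFin \o hermite_fun nu n])%E.

Definition rbf_basis gamma n q : quat R :=
  Num.sqrt (2 ^+ n / (gamma ^+ (2 * n) * n`!%:R)) *:
    (q ^+ n * exp_quat (- (gamma ^- 2 *: q ^+ 2))).

Definition rbf_kernel gamma q x : quat R :=
  limn (series
    (fun n => rbf_basis gamma n q *
              (normalized_hermite (2 / gamma ^+ 2) n x)%:A)).

Definition rbf_transform gamma psi q : quat R :=
  qintegral (fun x => rbf_kernel gamma q x * psi x).

Definition sb_kernel nu q x : quat R :=
  ((nu / pi) `^ (4^-1)) *: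
    exp_quat (- (nu / 2) *: (q ^+ 2 + (x ^+ 2)%:A)
          + (nu * Num.sqrt 2) *: (q * x%:A)).

Definition sb_transform nu psi q : quat R :=
  qintegral (fun x => sb_kernel nu q x * psi x).

(* [expmul a] is the operator M^a : g |-> (q |-> e^(q^2 / a) g(q)). *)
Definition expmul (a : R) (g : quat R -> quat R) q : quat R :=
  exp_quat (a^-1 *: q ^+ 2) * g q.

End transforms.

(* Main.v *)
Require Import Defs.
From mathcomp Require Import all_boot all_order all_algebra.
From mathcomp Require Import all_classical all_reals all_analysis.
From mathcomp Require Import measurable_realfun ring lra.
Import Order.TTheory GRing.Theory Num.Theory.
Import numFieldNormedType.Exports.

(* Put [nu = 2 / gamma ^+ 2].  The Hermite function of index [n] is
   [H_n(x) e^(- nu x^2 / 2)] for the polynomials [H_n] with generating function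
   [sum_n H_n(x) t^n / n! = e^(2 nu x t - nu t^2)], and
   [H_(n+1) e^(- nu x^2) = - (H_n e^(- nu x^2))'] with [H_(n+1)' = 2 nu (n+1) H_n]
   gives the norms after one integration by parts.  All the normalizing constants
   then collapse: the [n]-th term of the RBF kernel is a constant independent of
   [n] times [e^(- nu x^2 / 2) e^(- q^2 / gamma^2) H_n(x) (q / sqrt 2)^n / n!], so the
   generating function at [t = q / sqrt 2], which makes sense in the commutative
   subalgebra generated by [q], identifies the RBF kernel with [e^(- q^2 / gamma^2)]
   times the Segal-Bargmann kernel.  The Gaussian decay of the latter
   makes it square integrable in [x], and the left factor leaves the integral. *)

Set Implicit Arguments.
Unset Strict Implicit.
Unset Printing Implicit Defensive.
Local Open Scope classical_set_scope.
Local Open Scope ring_scope.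

(** * Quaternionic exponential series *)

Section quat_norm.
Context {R : realType}.
Implicit Types p q r : quat R.

Lemma sqr_norm_quat q :
  `|q| ^+ 2 = qRe q ^+ 2 + qI q ^+ 2 + qJ q ^+ 2 + qK q ^+ 2.
Proof. by rewrite sqr_sqrtr// !addr_ge0 ?sqr_ge0. Qed.

(** After squaring, this is Euler's four-square identity. *)
Lemma norm_quatM p q : `|p * q| = `|p| * `|q|.
Proof.
apply/eqP; rewrite -(@eqrXn2 _ 2) ?mulr_ge0//; apply/eqP.
by rewrite exprMn !sqr_norm_quat /=; ring.
Qed.

Lemma norm_quat1 : `|1 : quat R| = 1.
Proof.
by apply/eqP; rewrite -(@eqrXn2 _ 2)// sqr_norm_quat /= expr0n expr1n !addr0.
Qed.

Lemma norm_quatX q n : `|q ^+ n| = `|q| ^+ n.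
Proof.
by elim: n => [|n IHn]; rewrite ?norm_quat1// !exprS norm_quatM IHn.
Qed.

Lemma coord_le_norm_quat q :
  [/\ `|qRe q| <= `|q|, `|qI q| <= `|q|, `|qJ q| <= `|q| & `|qK q| <= `|q|].
Proof.
have h x : x ^+ 2 <= `|q| ^+ 2 -> `|x| <= `|q|.
  by move=> xq; rewrite -(@ler_pXn2r _ 2) ?nnegrE// real_normK ?num_real.
move: (sqr_ge0 (qRe q)) (sqr_ge0 (qI q)) (sqr_ge0 (qJ q)) (sqr_ge0 (qK q)) => ? ? ? ?.
by split; apply: h; rewrite sqr_norm_quat; lra.
Qed.

Lemma norm_quat_le q : `|q| <= `|qRe q| + `|qI q| + `|qJ q| + `|qK q|.
Proof.
rewrite -(@ler_pXn2r _ 2) ?nnegrE ?addr_ge0// sqr_norm_quat.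
rewrite -(real_normK (num_real (qRe q))) -(real_normK (num_real (qI q))).
rewrite -(real_normK (num_real (qJ q))) -(real_normK (num_real (qK q))).
move: (normr_ge0 (qRe q)) (normr_ge0 (qI q)) (normr_ge0 (qJ q)) (normr_ge0 (qK q)).
move: `|qRe q| `|qI q| `|qJ q| `|qK q| => a b c d a0 b0 c0 d0.
rewrite -subr_ge0 (_ : _ - _ =
  2 * (a * b + a * c + a * d + b * c + b * d + c * d)); last by ring.
by rewrite mulr_ge0// !addr_ge0// mulr_ge0.
Qed.

Lemma cvg_quat (u : nat -> quat R) q :
  qRe \o u @ \oo --> qRe q -> qI \o u @ \oo --> qI q ->
  qJ \o u @ \oo --> qJ q -> qK \o u @ \oo --> qK q -> u @ \oo --> q.
Proof.
move=> uR uI uJ uK; apply/cvgrPdist_le => e e0.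
have e4 : 0 < e / 4 by rewrite divr_gt0.
move/cvgrPdist_le : uR => /(_ _ e4) uR; move/cvgrPdist_le : uI => /(_ _ e4) uI.
move/cvgrPdist_le : uJ => /(_ _ e4) uJ; move/cvgrPdist_le : uK => /(_ _ e4) uK.
near=> n; apply: le_trans (norm_quat_le _) _ => /=.
rewrite (_ : e = e / 4 + e / 4 + e / 4 + e / 4); last by field.
by rewrite !lerD//; near: n.
Unshelve. all: by end_near. Qed.

Lemma cvg_quat_coord (u : nat -> quat R) q : u @ \oo --> q ->
  [/\ qRe \o u @ \oo --> qRe q, qI \o u @ \oo --> qI q,
      qJ \o u @ \oo --> qJ q & qK \o u @ \oo --> qK q].
Proof.
move=> uq; split; apply/cvgrPdist_le => e e0;
  move/cvgrPdist_le : uq => /(_ _ e0) uq; near=> n;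
  have [hR hI hJ hK] := coord_le_norm_quat (q - u n);
  [apply: le_trans hR _|apply: le_trans hI _|apply: le_trans hJ _
  |apply: le_trans hK _]; near: n; exact: uq.
Unshelve. all: by end_near. Qed.

Lemma qRe_series (u : nat -> quat R) : qRe \o series u = series (qRe \o u).
Proof.
by apply/funext => n; exact: (big_morph qRe (fun _ _ => erefl) erefl).
Qed.

Lemma qI_series (u : nat -> quat R) : qI \o series u = series (qI \o u).
Proof.
by apply/funext => n; exact: (big_morph qI (fun _ _ => erefl) erefl).
Qed.

Lemma qJ_series (u : nat -> quat R) : qJ \o series u = series (qJ \o u).
Proof.
by apply/funext => n; exact: (big_morph qJ (fun _ _ => erefl) erefl).
Qed.

Lemma qK_series (u : nat -> quat R) : qK \o series u = series (qK \o u).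
Proof.
by apply/funext => n; exact: (big_morph qK (fun _ _ => erefl) erefl).
Qed.

(** Completeness is only used in [R]: each coordinate is bounded by the norm, so the four coordinate
    series converge absolutely, and their sums are the coordinates of the limit. *)
Lemma normed_cvg_quat (u : nat -> quat R) :
  cvgn (series (fun n => `|u n|)) -> cvgn (series u).
Proof.
move=> cu.
have h (f : quat R -> R) : (forall q, `|f q| <= `|q|) -> cvgn (series (f \o u)).
  move=> fq; apply: normed_cvg; apply: series_le_cvg cu => n //=.
apply/cvg_ex; exists (Quat (limn (series (qRe \o u))) (limn (series (qI \o u)))
  (limn (series (qJ \o u))) (limn (series (qK \o u)))).
apply: cvg_quat; rewrite ?(qRe_series,qI_series,qJ_series,qK_series);
  by apply: h => q; have [] := coord_le_norm_quat q.
Qed.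

Lemma cvg_mul_quat (u v : nat -> quat R) p q :
  u @ \oo --> p -> v @ \oo --> q -> (fun n => u n * v n) @ \oo --> p * q.
Proof.
move=> /cvg_quat_coord[uR uI uJ uK] /cvg_quat_coord[vR vI vJ vK].
apply: cvg_quat.
- exact: (cvgB (cvgB (cvgB (cvgM uR vR) (cvgM uI vI)) (cvgM uJ vJ)) (cvgM uK vK)).
- exact: (cvgB (cvgD (cvgD (cvgM uR vI) (cvgM uI vR)) (cvgM uJ vK)) (cvgM uK vJ)).
- exact: (cvgD (cvgD (cvgB (cvgM uR vJ) (cvgM uI vK)) (cvgM uJ vR)) (cvgM uK vI)).
- exact: (cvgD (cvgB (cvgD (cvgM uR vK) (cvgM uI vJ)) (cvgM uJ vI)) (cvgM uK vR)).
Qed.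

Lemma cvg_scale_quat (a : R) (u : nat -> quat R) p :
  u @ \oo --> p -> (fun n => a *: u n) @ \oo --> a *: p.
Proof. by move=> up; exact: cvgZl_tmp. Qed.

End quat_norm.

(** * Cauchy products of absolutely convergent quaternionic series *)

Section cauchy_product.
Context {R : realType}.

(** The triangle [i + j < N] is summed along antidiagonals and along rows; raising [N] by one adds
    one antidiagonal, that is, one entry at the end of each row. *)
Lemma sum_triangle (V : zmodType) (F : nat -> nat -> V) N :
  \sum_(0 <= n < N) \sum_(0 <= i < n.+1) F i (n - i)%N =
  \sum_(0 <= i < N) \sum_(0 <= j < N - i) F i j.
Proof.
elim: N => [|N IHN]; first by rewrite !big_geq.
rewrite big_nat_recr//= IHN [RHS]big_nat_recr//= subSnn big_nat1.
rewrite big_nat_recr//= subnn addrA -big_split/=; congr (_ + _).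
apply: eq_big_nat => i /andP[_ iN].
by rewrite subSn 1?ltnW// [RHS]big_nat_recr.
Qed.

(** The square of side [N] minus the triangle [i + j < N] leaves the corner [i + j >= N]. *)
Lemma series_mul_triangle (A : pzRingType) (a b : nat -> A) N :
  series a N * series b N -
    series (fun n => \sum_(0 <= i < n.+1) a i * b (n - i)%N) N =
  \sum_(0 <= i < N) \sum_(N - i <= j < N) a i * b j.
Proof.
rewrite /series /= (sum_triangle (fun i j => a i * b j)) big_distrl/=.
apply/eqP; rewrite subr_eq -big_split/=; apply/eqP.
apply: eq_bigr => i _; rewrite big_distrr/= addrC -big_cat_nat//=.
exact: leq_subr.
Qed.

(** The square of side [N./2] lies inside the triangle [i + j < N], and all terms are
    nonnegative. *)
Lemma series_mul_half_le (a b : nat -> R) N :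
  (forall n, 0 <= a n) -> (forall n, 0 <= b n) ->
  series a N./2 * series b N./2 <=
    series (fun n => \sum_(0 <= i < n.+1) a i * b (n - i)%N) N.
Proof.
move=> a0 b0; rewrite /series /= (sum_triangle (fun i j => a i * b j)).
have hN : (N./2 <= N)%N by rewrite -[leqRHS]odd_double_half -addnn addnA leq_addl.
rewrite [leRHS](big_cat_nat _ hN)//= big_distrl/= ler_wpDr//.
  by do 2 (apply: sumr_ge0 => ? _); rewrite mulr_ge0.
apply: ler_sum_nat => i /andP[_ iN]; rewrite big_distrr/=.
have hi : (N./2 <= N - i)%N.
  rewrite leq_subRL; last exact: leq_trans (ltnW iN) hN.
  rewrite -[leqRHS]odd_double_half -addnn addnA leq_add2r.
  by rewrite (leq_trans (ltnW iN))// leq_addl.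
rewrite [leRHS](big_cat_nat _ hi)//= ler_wpDr//.
by apply: sumr_ge0 => ? _; rewrite mulr_ge0.
Qed.

Lemma cvg_half : (fun n => n./2) @ \oo --> \oo.
Proof.
apply/cvgnyPge => A; near=> n.
rewrite -[leqLHS]doubleK half_leq//; near: n; exact: nbhs_infty_ge.
Unshelve. all: by end_near. Qed.

(* The defect is dominated by the one of the series of norms, where
   positivity squeezes the triangular sum between two products. *)
Lemma cauchy_product (a b : nat -> quat R) (A B : quat R) :
  cvgn (series (fun n => `|a n|)) -> cvgn (series (fun n => `|b n|)) ->
  series a @ \oo --> A -> series b @ \oo --> B ->
  series (fun n => \sum_(0 <= i < n.+1) a i * b (n - i)%N) @ \oo --> A * B.
Proof.
move=> ca cb aA bB; set c := (X in series X).
set na := fun n => `|a n|; set nb := fun n => `|b n|.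
pose D N := series na N * series nb N - series na N./2 * series nb N./2.
have D0 : D @ \oo --> (0 : R).
  rewrite -[X in _ --> X](subrr (limn (series na) * limn (series nb))).
  apply: cvgB; apply: cvgM => //.
    exact: (cvg_comp _ _ cvg_half ca).
  exact: (cvg_comp _ _ cvg_half cb).
have cD N : `|series a N * series b N - series c N| <= D N.
  rewrite series_mul_triangle.
  apply: (@le_trans _ _ (\sum_(0 <= i < N) \sum_(N - i <= j < N) na i * nb j)).
    apply: le_trans (ler_norm_sum _ _ _) _; apply: ler_sum => i _.
    apply: le_trans (ler_norm_sum _ _ _) _; apply: ler_sum => j _.
    by rewrite norm_quatM.
  rewrite -series_mul_triangle /D lerB//.
  by apply: series_mul_half_le => n; exact: normr_ge0.
have abc : (fun N => series a N * series b N - series c N) @ \oo --> (0 : quat R).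
  apply/cvgrPdist_le => e e0; move/cvgrPdist_le : D0 => /(_ _ e0) D0.
  near=> N; rewrite sub0r normrN (le_trans (cD N))//.
  by rewrite (le_trans (ler_norm _))// -normrN -sub0r; near: N.
rewrite (_ : series c = fun N => series a N * series b N -
    (series a N * series b N - series c N)); last first.
  by apply/funext => N; rewrite opprB addrC subrK.
by rewrite -[X in _ --> X]subr0; apply: cvgB => //; exact: cvg_mul_quat.
Unshelve. all: by end_near. Qed.

End cauchy_product.

(** * The quaternionic exponential: norm bound and additivity on commuting arguments *)

Section exp_quat_theory.
Context {R : realType}.
Implicit Types (p q r : quat R) (n : nat).

Lemma norm_exp_quat_term q n : `|n`!%:R^-1 *: q ^+ n| = exp_coeff `|q| n.
Proof.
by rewrite normrZ norm_quatX exp_coeffE ger0_norm// invr_ge0 ler0n.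
Qed.

Lemma norm_exp_series_cvg q : cvgn (series (fun n => `|n`!%:R^-1 *: q ^+ n|)).
Proof.
under eq_fun do rewrite norm_exp_quat_term.
exact: is_cvg_series_exp_coeff.
Qed.

Lemma exp_quat_cvg q : series (fun n => n`!%:R^-1 *: q ^+ n) @ \oo --> exp_quat q.
Proof. exact/normed_cvg_quat/norm_exp_series_cvg. Qed.

(** Partial sums are dominated by those of the real exponential series, which increase to their
    limit. The bound later controls the growth of the Segal-Bargmann kernel in [x]. *)
Lemma norm_exp_quat_le q : `|exp_quat q| <= expR `|q|.
Proof.
have h : (fun n => `|series (fun n => n`!%:R^-1 *: q ^+ n) n|) @ \oo -->
    `|exp_quat q| by apply: cvg_norm; exact: exp_quat_cvg.
apply: (cvgr_to_le h) => {h}.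
near=> n; apply: le_trans (ler_norm_sum _ _ _) _.
under eq_bigr do rewrite norm_exp_quat_term.
apply: nondecreasing_cvgn_le; last exact: is_cvg_series_exp_coeff.
by apply: nondecreasing_series => ? _ _; exact: exp_coeff_ge0.
Unshelve. all: by end_near. Qed.

Lemma exp_quatD p r : p * r = r * p -> exp_quat (p + r) = exp_quat p * exp_quat r.
Proof.
move=> pr; apply/cvg_lim => //.
rewrite (_ : (fun n => _) = fun n => \sum_(0 <= i < n.+1)
    i`!%:R^-1 *: p ^+ i * ((n - i)`!%:R^-1 *: r ^+ (n - i)%N)).
  by apply: (@cauchy_product _ (fun n => n`!%:R^-1 *: p ^+ n)
      (fun n => n`!%:R^-1 *: r ^+ n));
    [exact: norm_exp_series_cvg|exact: norm_exp_series_cvg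
    |exact: exp_quat_cvg|exact: exp_quat_cvg].
(* Binomial theorem for commuting elements. The swap of the summands gives [p] the exponent [i], as
   in the Cauchy product; the factors are put back in order by commutation. *)
apply/funext => n; rewrite addrC exprDn_comm//.
rewrite scaler_sumr big_mkord; apply: eq_bigr => -[i/=]; rewrite ltnS => ni _.
rewrite -scalerMnr scalerMnl -scalerAl -scalerAr [RHS]scalerA.
congr (_ *: _); last by apply: commrX; apply: commr_sym; apply: commrX.
rewrite -mulr_natr -(bin_fact ni) !natrM.
field.
by rewrite !pnatr_eq0 -!lt0n !fact_gt0 bin_gt0 ni.
Qed.

Lemma exp_quatC p r : p * r = r * p ->
  exp_quat p * exp_quat r = exp_quat r * exp_quat p.
Proof. by move=> pr; rewrite -(exp_quatD pr) -(exp_quatD (esym pr)) addrC. Qed.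

Lemma exp_quat_real (a : R) : exp_quat (a%:A : quat R) = (expR a)%:A.
Proof.
apply/cvg_lim => //.
have -> : series (fun n => n`!%:R^-1 *: (a%:A : quat R) ^+ n) =
    fun n => (series (exp_coeff a) n)%:A.
  apply/funext => n; rewrite /series/= scaler_suml; apply: eq_bigr => i _.
  by rewrite exprZn expr1n scalerA exp_coeffE.
by apply: cvgZr_tmp; exact: is_cvg_series_exp_coeff.
Qed.

End exp_quat_theory.

(** * Gaussian integrals and Hermite functions *)

Section gaussian.
Context {R : realType}.
Variable nu : R.
Hypothesis nu_gt0 : 0 < nu.
Local Notation mu := (@lebesgue_measure R).

Definition gaussian (nu x : R) : R := expR (- (nu * x ^+ 2)).

(** The standard deviation with [2 s^2 = 1 / nu]: the centred normal density is then a multiple of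
    [gaussian nu], which yields integrability and total mass. *)
Let s := Num.sqrt ((2 * nu)^-1).

Let s2 : s ^+ 2 *+ 2 = nu^-1.
Proof.
rewrite sqr_sqrtr ?invr_ge0 ?mulr_ge0 ?ltW// -mulr_natr.
by field; rewrite gt_eqF.
Qed.

Let s_neq0 : s != 0.
Proof. by rewrite gt_eqF// sqrtr_gt0 invr_gt0 mulr_gt0. Qed.

Let gaussianE x : gaussian nu x = Num.sqrt (pi / nu) * normal_pdf 0 s x.
Proof.
rewrite normal_pdfE// /normal_peak /normal_fun subr0 s2 -mulrnAl s2.
rewrite (mulrC _^-1 pi) mulrA divff ?mul1r; last first.
  by rewrite gt_eqF// sqrtr_gt0 divr_gt0// pi_gt0.
by rewrite /gaussian invrK mulNr mulrC.
Qed.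

Lemma integrable_gaussian : mu.-integrable [set: R] (EFin \o gaussian nu).
Proof.
rewrite (_ : _ \o _ =
  (fun x => (Num.sqrt (pi / nu))%:E * (normal_pdf 0 s x)%:E)%E); last first.
  by apply/funext => x /=; rewrite gaussianE EFinM.
by apply: integrableZl => //; exact: integrable_normal_pdf.
Qed.

Lemma integral_gaussian : \int[mu]_x gaussian nu x = Num.sqrt (pi / nu).
Proof.
under eq_Rintegral do rewrite gaussianE.
rewrite RintegralZl//; last exact: integrable_normal_pdf.
by rewrite /Rintegral integral_normal_pdf mulr1.
Qed.

End gaussian.

(** * Polynomials times a Gaussian: decay, integrability, integration by parts *)

Section poly_gaussian.
Context {R : realType}.
Implicit Types (p : {poly R}) (x : R).
Variable nu : R.
Hypothesis nu_gt0 : 0 < nu.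
Local Notation mu := (@lebesgue_measure R).

(** Induction in Horner form, for all [e] at once: a factor [x] consumes half of the exponent, since
    [|x| <= 1 + x^2 <= (1 + 2 / e) exp (e x^2 / 2)]. *)
Lemma poly_le_expR_sqr p (e : R) : 0 < e ->
  exists2 C : R, 0 <= C & forall x, `|p.[x]| <= C * expR (e * x ^+ 2).
Proof.
elim/poly_ind: p e => [|p c IHp] e e0.
  by exists 0 => // x; rewrite horner0 normr0 mul0r.
have e2 : 0 < e / 2 by rewrite divr_gt0.
have [C C0 hC] := IHp _ e2.
exists (C * (1 + (e / 2)^-1) + `|c|).
  by rewrite addr_ge0// mulr_ge0// addr_ge0// invr_ge0 ltW.
move=> x; rewrite hornerMXaddC (le_trans (ler_normD _ _))// mulrDl lerD//.
  rewrite normrM (_ : e * x ^+ 2 = e / 2 * x ^+ 2 + e / 2 * x ^+ 2); last by field.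
  rewrite expRD mulrACA ler_pM//.
  have xx (t : R) : t <= 1 + t ^+ 2 by nra.
  apply: le_trans (xx _) _; rewrite real_normK ?num_real//.
  have e21 : 1 <= expR (e / 2 * x ^+ 2).
    by rewrite -[leLHS]expR0 ler_expR mulr_ge0 ?sqr_ge0// ltW.
  rewrite mulrDl mul1r lerD//.
  rewrite mulrC ler_pdivlMr//.
  by rewrite mulrC; apply: le_trans (expR_ge1Dx _); rewrite lerDr.
by rewrite ler_peMr// -expR0 ler_expR mulr_ge0 ?sqr_ge0// ltW.
Qed.

Lemma continuous_gaussian : continuous (gaussian nu).
Proof.
move=> x; apply: (@continuous_comp _ _ _ (fun x => - (nu * x ^+ 2)) expR).
  by apply: cvgN; apply: cvgM; [exact: cvg_cst|exact: exprn_continuous].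
exact: continuous_expR.
Qed.

Lemma continuous_poly_gaussian p : continuous (fun x => p.[x] * gaussian nu x).
Proof.
by move=> x; apply: cvgM; [exact: continuous_horner|exact: continuous_gaussian].
Qed.

(** Half of the exponent absorbs the polynomial, the other half remains as an integrable bound. *)
Lemma poly_gaussian_le p : exists2 C : R, 0 <= C &
  forall x, `|p.[x] * gaussian nu x| <= C * gaussian (nu / 2) x.
Proof.
have [C C0 hC] := @poly_le_expR_sqr p (nu / 2) (divr_gt0 nu_gt0 (ltr0Sn _ _)).
exists C => // x; rewrite normrM [`|gaussian _ _|]ger0_norm ?expR_ge0//.
rewrite (_ : gaussian nu x = expR (- (nu / 2 * x ^+ 2)) * gaussian (nu / 2) x).
  rewrite mulrA ler_wpM2r ?expR_ge0//.
  apply: le_trans (ler_wpM2r (expR_ge0 _) (hC x)) _.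
  by rewrite -[leLHS]mulrA -expRD subrr expR0 mulr1.
by rewrite /gaussian -expRD; congr expR; field.
Qed.

Lemma integrable_poly_gaussian p :
  mu.-integrable [set: R] (EFin \o (fun x => p.[x] * gaussian nu x)).
Proof.
have [C C0 hC] := poly_gaussian_le p.
have ig : mu.-integrable [set: R] (fun x => C%:E * (gaussian (nu / 2) x)%:E)%E.
  by apply: integrableZl => //; apply: integrable_gaussian; exact: divr_gt0.
apply: le_integrable ig => //.
  apply/measurable_EFinP; apply: continuous_measurable_fun.
  exact: continuous_poly_gaussian.
by move=> x _ /=; rewrite lee_fin (le_trans (hC x))// ler_norm.
Qed.

Lemma is_derive_gaussian x :
  is_derive x (1 : R) (gaussian nu) (- (2 * nu * x) * gaussian nu x).
Proof.
rewrite /gaussian; apply: trigger_derive; rewrite /GRing.scale/=; ring.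
Qed.

Lemma is_derive_poly_gaussian p x :
  is_derive x (1 : R) (fun y => p.[y] * gaussian nu y)
    ((p^`() - (2 * nu) *: ('X * p)).[x] * gaussian nu x).
Proof.
have dg := is_derive_gaussian x.
apply: trigger_derive; rewrite /GRing.scale/=.
rewrite hornerD hornerN hornerZ hornerM hornerX; ring.
Qed.

(** The absolute value lets [a] run through either endpoint of the intervals [[-(n+1), n+1]]. The
    decay comes from [exp (- t) <= 1 / t] at [t = nu (n+1)^2 / 2], which is at least
    [nu (n+1) / 2]. *)
Lemma cvg_poly_gaussian p (a : nat -> R) : (forall n, `|a n| = n.+1%:R) ->
  (fun n => p.[a n] * gaussian nu (a n)) @ \oo --> (0 : R).
Proof.
move=> an; have [C C0 hC] := poly_gaussian_le p.
apply: norm_cvg0.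
apply: (@squeeze_cvgr _ _ _ _ (cst 0) (fun n => C * (nu / 2)^-1 * harmonic n)).
- near=> n; rewrite normr_ge0/= (le_trans (hC _))// -mulrA ler_wpM2l//.
  rewrite /gaussian expRN -invfM lef_pV2 ?posrE ?expR_gt0//; last first.
    by rewrite !mulr_gt0.
  apply: le_trans (expR_ge1Dx _).
  apply: (@le_trans _ _ (nu / 2 * a n ^+ 2)); last by rewrite lerDr.
  rewrite ler_wpM2l ?(ltW (divr_gt0 _ _))// -real_normK ?num_real// an.
  by rewrite expr2 ler_peMr// ler1n.
- exact: cvg_cst.
- rewrite -[X in _ --> X](mulr0 (C * (nu / 2)^-1)).
  by apply: cvgMl_tmp; exact: cvg_harmonic.
Unshelve. all: by end_near. Qed.

(** The integrand is the derivative of [p] times the Gaussian. Over [[-(n+1), n+1]] its integral is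
    a difference of boundary values tending to 0, and dominated convergence passes to the whole
    line. *)
Lemma Rintegral_derive_poly_gaussian p :
  \int[mu]_x ((p^`() - (2 * nu) *: ('X * p)).[x] * gaussian nu x) = 0.
Proof.
set q := (_ - _); pose f x := q.[x] * gaussian nu x.
pose F x := p.[x] * gaussian nu x.
pose A n := `[(- n.+1%:R : R), n.+1%:R].
have intf : mu.-integrable [set: R] (EFin \o f) by exact: integrable_poly_gaussian.
have mf : measurable_fun [set: R] f.
  by apply: continuous_measurable_fun; exact: continuous_poly_gaussian.
have FTC n : (\int[mu]_(x in [set` A n]) (f x)%:E =
              (F n.+1%:R)%:E - (F (- n.+1%:R))%:E)%E.
  apply: continuous_FTC2.
  - by rewrite gtrN.
  - by apply: continuous_subspaceT; exact: continuous_poly_gaussian.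
  - split.
    + by move=> x _; have [] := is_derive_poly_gaussian p x.
    + by apply: cvg_at_right_filter; exact: continuous_poly_gaussian.
    + by apply: cvg_at_left_filter; exact: continuous_poly_gaussian.
  - by move=> x _; rewrite derive1E; have [_ ->] := is_derive_poly_gaussian p x.
have lim0 : (fun n => \int[mu]_(x in [set` A n]) (f x)%:E)%E @ \oo --> 0%E.
  under eq_fun do rewrite FTC -EFinB.
  apply: cvg_EFin; first by apply: nearW.
  rewrite -[X in _ --> X](subr0 0).
  by apply: cvgB; apply: cvg_poly_gaussian => n; rewrite ?normrN normr_nat.
rewrite /Rintegral (_ : (\int[mu]_x _)%E = 0%E)//.
suff h : (fun n => \int[mu]_(x in [set` A n]) (f x)%:E)%E @ \oo -->
    (\int[mu]_x (EFin \o f) x)%E by exact: (cvg_unique _ h lim0).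
under eq_fun do rewrite integral_mkcond.
have [] := @dominated_convergence _ _ _ mu [set: R] measurableT
  (fun n => (EFin \o f) \_ [set` A n]) (EFin \o f) (abse \o (EFin \o f)).
- move=> n; apply/(measurable_restrictT _ _).1 => //.
  by apply/measurable_EFinP; exact: measurable_funTS.
- exact/measurable_EFinP.
(* The truncated integrand is stationary at [x] once [n] reaches the integer part of [|x|], as the
   radius is [n + 1]. *)
- apply: aeW => x _; apply: cvg_near_cst; near=> n.
  rewrite patchE mem_set//= in_itv/= -ler_norml.
  near: n; exists (Num.truncn `|x|) => // n /= xn.
  apply: ltW; apply: lt_le_trans (truncnS_gt _) _.
  by rewrite ler_nat ltnS.
- exact: integrable_abse.
- by apply: aeW => x n _; rewrite patchE; case: ifP => //= _; rewrite lee_fin normr0.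
Unshelve. all: by end_near. Qed.

End poly_gaussian.

(** * Hermite polynomials for the weight [exp (- nu x^2)] and the norms of the Hermite functions *)

Section hermite.
Context {R : realType}.
Implicit Types (n : nat) (x : R).

(** The recursion obtained by differentiating [H_n exp (- nu x^2)] and changing the sign; [nu = 1]
    gives the physicists' Hermite polynomials. *)
Fixpoint hermite_poly (nu : R) n : {poly R} :=
  if n is m.+1 then (2 * nu) *: ('X * hermite_poly nu m) - (hermite_poly nu m)^`()
  else 1.

Lemma hermite_polyS nu n : hermite_poly nu n.+1 =
  (2 * nu) *: ('X * hermite_poly nu n) - (hermite_poly nu n)^`().
Proof. by []. Qed.

(** When the recursion is differentiated, the induction hypothesis produces terms in [X H_n] and
    [H_n']; eliminating [H_n'] by the recursion cancels the former and leaves a multiple of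
    [H_(n+1)]. *)
Lemma deriv_hermite_poly nu n :
  (hermite_poly nu n.+1)^`() = (2 * nu * n.+1%:R) *: hermite_poly nu n.
Proof.
elim: n => [|n IHn].
  by rewrite /= -polyC1 derivC subr0 polyC1 mulr1 derivZ derivX mulr1.
rewrite hermite_polyS derivB derivZ derivM derivX mul1r IHn derivZ.
have -> : (hermite_poly nu n)^`() =
    (2 * nu) *: ('X * hermite_poly nu n) - hermite_poly nu n.+1.
  by rewrite hermite_polyS opprB addrC subrK.
move: (hermite_poly nu n.+1) (hermite_poly nu n) => p q.
rewrite -scalerAr scalerDr scalerBr !scalerA.
rewrite opprB [in LHS]addrC [X in _ + X]addrC (mulrC (2 * nu * _) (2 * nu)).
by rewrite subrKA -scalerDl -[n.+2%:R]natr1 mulrDr mulr1.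
Qed.

(** This derivative-free recurrence is the one to be matched with the coefficients of the generating
    function. *)
Lemma hermite_polyS2 nu n : hermite_poly nu n.+2 =
  (2 * nu) *: ('X * hermite_poly nu n.+1) - (2 * nu * n.+1%:R) *: hermite_poly nu n.
Proof. by rewrite hermite_polyS deriv_hermite_poly. Qed.

Variable nu : R.
Hypothesis nu_gt0 : 0 < nu.
Local Notation mu := (@lebesgue_measure R).

(** Rodrigues' formula. *)
Lemma derive1n_gaussian n : derive1n n (gaussian nu) =
  (fun x => (-1) ^+ n * (hermite_poly nu n).[x] * gaussian nu x).
Proof.
elim: n => [|n IHn].
  by apply/funext => x /=; rewrite -polyC1 hornerC !mul1r.
rewrite derive1nS IHn; apply/funext => x; rewrite derive1E.
have := is_derive_poly_gaussian nu ((-1) ^+ n *: hermite_poly nu n) x.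
under [X in is_derive _ _ X _]eq_fun do rewrite hornerZ.
move=> [_ ->]; rewrite -hornerZ; congr (_.[x] * _).
rewrite derivZ hermite_polyS exprS mulN1r scaleNr scalerBr opprB.
by rewrite -scalerAr !scalerA (mulrC (2 * nu)).
Qed.

Lemma hermite_funE n x :
  hermite_fun nu n x = (hermite_poly nu n).[x] * expR (- (nu / 2 * x ^+ 2)).
Proof.
rewrite /hermite_fun derive1n_gaussian.
have : (-1) ^+ n * (-1) ^+ n = 1 :> R by rewrite -expr2 sqrr_sign.
move: ((-1) ^+ n) => e ee.
rewrite (_ : _ * _ * _ =
  e * e * ((hermite_poly nu n).[x] * (expR (nu / 2 * x ^+ 2) * gaussian nu x)));
  last by ring.
by rewrite ee mul1r -expRD; congr (_ * expR _); field.
Qed.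

Lemma int_hermite_poly_sqr m : mu.-integrable [set: R]
  (EFin \o (fun x => (hermite_poly nu m).[x] ^+ 2 * gaussian nu x)).
Proof.
have := integrable_poly_gaussian nu_gt0 (hermite_poly nu m ^+ 2).
by under [X in _ \o X]eq_fun do rewrite horner_exp.
Qed.

(** Integration by parts with [p = H_(n+1) H_n]: the vanishing integral is that of
    [2 nu (n+1) H_n^2 - H_(n+1)^2] against the weight, which links consecutive norms. *)
Lemma Rintegral_hermite_poly_sqr n :
  \int[mu]_x ((hermite_poly nu n).[x] ^+ 2 * gaussian nu x) =
  (2 * nu) ^+ n * n`!%:R * Num.sqrt (pi / nu).
Proof.
elim: n => [|n IHn].
  under eq_Rintegral do rewrite /= -polyC1 hornerC expr1n mul1r.
  by rewrite integral_gaussian// expr0 !mul1r.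
have := Rintegral_derive_poly_gaussian nu_gt0 (hermite_poly nu n.+1 * hermite_poly nu n).
have -> : (hermite_poly nu n.+1 * hermite_poly nu n)^`() -
    (2 * nu) *: ('X * (hermite_poly nu n.+1 * hermite_poly nu n)) =
  (2 * nu * n.+1%:R) *: (hermite_poly nu n ^+ 2) - hermite_poly nu n.+1 ^+ 2.
  rewrite derivM deriv_hermite_poly -scalerAl -expr2 -addrA; congr (_ + _).
  (* Only one factor of [H_(n+1)^2] is unfolded, to meet [H_(n+1) (H_n' - 2 nu X H_n)]. *)
  rewrite expr2 {4}hermite_polyS mulrBr -scalerAr opprB; congr (_ - _).
  by rewrite mulrCA.
set c := 2 * nu * n.+1%:R.
under eq_Rintegral do rewrite hornerD hornerN hornerZ !horner_exp mulrBl -mulrA.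
rewrite RintegralB//; [|exact: (integrableZl measurableT c (int_hermite_poly_sqr n))
  |exact: int_hermite_poly_sqr].
rewrite RintegralZl//; last exact: int_hermite_poly_sqr.
rewrite IHn => /eqP; rewrite subr_eq0 => /eqP <-.
by rewrite /c factS natrM exprS; ring.
Qed.

Lemma Lnorm_hermite_fun n : fine ('N[mu]_2%:E [EFin \o hermite_fun nu n])%E =
  Num.sqrt ((2 * nu) ^+ n * n`!%:R * Num.sqrt (pi / nu)).
Proof.
rewrite unlock.
under eq_integral => x _.
  rewrite /= hermite_funE powR_mulrn// real_normK ?num_real// exprMn.
  rewrite (_ : expR _ ^+ 2 = gaussian nu x); last first.
    by rewrite /gaussian -expRM_natl; congr expR; field.
  over.
rewrite -Rintegral_hermite_poly_sqr /Rintegral.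
set I := (\int[mu]_x _)%E.
(* Finiteness turns the extended-real power into a real square root. *)
have /fineK <- : I \is a fin_num
  by apply: integrable_fin_num => //; exact: int_hermite_poly_sqr.
rewrite poweR_EFin /= powR12_sqrt// fine_ge0// integral_ge0// => x _.
by rewrite lee_fin mulr_ge0 ?sqr_ge0 ?expR_ge0.
Qed.

End hermite.

(** * The Hermite generating function and the kernels *)

Section generating_function.
Context {R : realType}.
Implicit Types (q : quat R) (a b nu x : R) (n : nat).

(** Among the indices below [n], exactly [uphalf n] are even. *)
Lemma series_even (V : zmodType) (u : nat -> V) n :
  series (fun k => if odd k then 0 else u k./2) n = series u (uphalf n).
Proof.
elim: n => [|n IHn]; first by rewrite /series /= !big_geq.
rewrite seriesSr IHn [uphalf n.+1]/= uphalf_half.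
by case: (odd n) => /=; rewrite ?addr0// add0n seriesSr.
Qed.

Lemma cvg_uphalf : uphalf @ \oo --> \oo.
Proof.
apply/cvgnyPge => A; near=> n; rewrite uphalf_half.
apply: leq_trans (leq_addl _ _); rewrite -[leqLHS]doubleK half_leq//.
by near: n; exact: nbhs_infty_ge.
Unshelve. all: by end_near. Qed.

(** The coefficient of [t ^+ n] in [exp (a * t ^+ 2)]; padding with zeros makes it a series in
    powers of [t], ready for a Cauchy product graded by degree. *)
Definition exp_sqr_coeff a n : R :=
  if odd n then 0 else exp_coeff a n./2.

Lemma exp_sqr_coeffZ a q :
  (fun n => exp_sqr_coeff a n *: q ^+ n) =
  fun n => if odd n then 0 else (n./2)`!%:R^-1 *: (a *: q ^+ 2) ^+ n./2.
Proof.
apply/funext => n; rewrite /exp_sqr_coeff; case: ifPn => [_|nodd].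
  by rewrite scale0r.
rewrite exprZn -exprM mul2n even_halfK// scalerA exp_coeffE.
by [].
Qed.

Lemma exp_sqr_cvg a q :
  series (fun n => exp_sqr_coeff a n *: q ^+ n) @ \oo -->
  exp_quat (a *: q ^+ 2).
Proof.
rewrite exp_sqr_coeffZ.
pose u k := k`!%:R^-1 *: (a *: q ^+ 2) ^+ k.
rewrite (_ : series _ = series u \o uphalf); last first.
  by apply/funext => n; exact: (series_even u).
exact: (cvg_comp _ _ cvg_uphalf (@exp_quat_cvg _ _)).
Qed.

Lemma exp_sqr_norm_cvg a q :
  cvgn (series (fun n => `|exp_sqr_coeff a n *: q ^+ n|)).
Proof.
pose u n := (n`!%:R^-1 *: (a *: q ^+ 2) ^+ n).
rewrite (_ : (fun n => _) = fun n => if odd n then 0 else `|u n./2|); last first.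
  apply/funext => n; rewrite (congr1 (@^~ n) (exp_sqr_coeffZ a q)) /=.
  by case: ifP; rewrite ?normr0.
rewrite (_ : series _ = series (fun k => `|u k|) \o uphalf); last first.
  by apply/funext => n; exact: (series_even (fun k => `|u k|)).
apply/cvg_ex; exists (limn (series (fun k => `|u k|))).
exact: (cvg_comp _ _ cvg_uphalf (@norm_exp_series_cvg _ _)).
Qed.

Lemma exp_lin_term b q n :
  exp_coeff b n *: q ^+ n = n`!%:R^-1 *: (b *: q) ^+ n.
Proof. by rewrite exprZn scalerA exp_coeffE. Qed.

(* The coefficient of [t ^+ n] in [exp (a * t ^+ 2 + b * t)]. *)
Definition exp_quad_coeff a b n : R :=
  \sum_(0 <= i < n.+1) exp_sqr_coeff a i * exp_coeff b (n - i)%N.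

(** All terms are real multiples of powers of the single quaternion [q], so the Cauchy product
    collects into a power series with real coefficients. *)
Lemma exp_quad_cvg a b q :
  series (fun n => exp_quad_coeff a b n *: q ^+ n) @ \oo -->
  exp_quat (a *: q ^+ 2) * exp_quat (b *: q).
Proof.
rewrite (_ : (fun n => _) = fun n => \sum_(0 <= i < n.+1)
   (exp_sqr_coeff a i *: q ^+ i) * (exp_coeff b (n - i)%N *: q ^+ (n - i)%N)).
  apply: (@cauchy_product _ (fun n => exp_sqr_coeff a n *: q ^+ n)
    (fun n => exp_coeff b n *: q ^+ n)).
  - exact: exp_sqr_norm_cvg.
  - by under eq_fun do rewrite exp_lin_term; exact: norm_exp_series_cvg.
  - exact: exp_sqr_cvg.
  - by under eq_fun do rewrite exp_lin_term; exact: exp_quat_cvg.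
apply/funext => n; rewrite scaler_suml; apply: eq_big_nat => i /andP[_].
rewrite ltnS => ni.
by rewrite -[RHS]scalerAl -[in RHS]scalerAr [RHS]scalerA -exprD subnKC.
Qed.

(** Coefficient form of [f' = 2 a t f] for [f = exp (a t^2)]. *)
Lemma exp_sqr_coeffSS a n :
  n.+2%:R * exp_sqr_coeff a n.+2 = 2 * a * exp_sqr_coeff a n.
Proof.
rewrite /exp_sqr_coeff /= negbK; case: ifPn => [|nodd]; first by rewrite !mulr0.
rewrite -{1}(even_halfK nodd) /exp_coeff /= factS exprS natrM.
rewrite -doubleS -muln2 natrM.
by field; rewrite nat1r !pnatr_eq0 -lt0n fact_gt0.
Qed.

Lemma exp_coeffS b n : n.+1%:R * exp_coeff b n.+1 = b * exp_coeff b n.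
Proof.
rewrite /exp_coeff /= factS exprS natrM.
by field; rewrite nat1r !pnatr_eq0 -lt0n fact_gt0.
Qed.

(** Coefficient form of [f' = (b + 2 a t) f]. Splitting [n + 2] as [(n + 2 - i) + i] is the product
    rule, and each part uses the recurrence of one factor. *)
Lemma exp_quad_coeffSS a b n : n.+2%:R * exp_quad_coeff a b n.+2 =
  b * exp_quad_coeff a b n.+1 + 2 * a * exp_quad_coeff a b n.
Proof.
rewrite /exp_quad_coeff.
have -> : n.+2%:R * (\sum_(0 <= i < n.+3)
      exp_sqr_coeff a i * exp_coeff b (n.+2 - i)%N) =
    \sum_(0 <= i < n.+3) exp_sqr_coeff a i *
      ((n.+2 - i)%:R * exp_coeff b (n.+2 - i)%N) +
    \sum_(0 <= i < n.+3) i%:R * exp_sqr_coeff a i * exp_coeff b (n.+2 - i)%N.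
  rewrite -big_split/= mulr_sumr; apply: eq_big_nat => i /andP[_].
  by rewrite ltnS => ni; rewrite -{1}(subnK ni) natrD; ring.
congr (_ + _).
  rewrite big_nat_recr//= subnn mul0r mulr0 addr0 mulr_sumr.
  apply: eq_big_nat => i /andP[_]; rewrite ltnS => ni.
  by rewrite subSn// exp_coeffS; ring.
(* The term [i = 0] vanishes by its factor [i], the term [i = 1] by parity; the remaining indices
   shift by two. *)
rewrite big_nat_recl// mul0r mul0r add0r big_nat_recl//.
rewrite {1}/exp_sqr_coeff /= mulr0 mul0r add0r mulr_sumr.
by apply: eq_bigr => i _; rewrite exp_sqr_coeffSS !subSS mulrA.
Qed.

(** The arguments come from [2 nu x t - nu t^2] at [t = q / sqrt 2]. Both sides obey the same
    second-order recurrence, so the induction carries two consecutive indices. *)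
Lemma exp_quad_coeff_hermite nu x n :
  exp_quad_coeff (- (nu / 2)) (nu * Num.sqrt 2 * x) n =
  (hermite_poly nu n).[x] / (Num.sqrt 2 ^+ n * n`!%:R).
Proof.
have s2 : Num.sqrt 2 ^+ 2 = 2 :> R by rewrite sqr_sqrtr.
have s0 : Num.sqrt 2 != 0 :> R by rewrite gt_eqF// sqrtr_gt0.
set s := Num.sqrt 2 in s2 s0 *.
suff : exp_quad_coeff (- (nu / 2)) (nu * s * x) n =
    (hermite_poly nu n).[x] / (s ^+ n * n`!%:R) /\
  exp_quad_coeff (- (nu / 2)) (nu * s * x) n.+1 =
    (hermite_poly nu n.+1).[x] / (s ^+ n.+1 * n.+1`!%:R) by case.
elim: n => [|n [IHn IHn1]]; split => //.
- by rewrite /exp_quad_coeff big_nat1 /exp_sqr_coeff /exp_coeff /= -polyC1 hornerC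
    !expr0 fact0 !mulr1 !divr1 mulr1.
- rewrite /exp_quad_coeff big_ltn// big_nat1 /exp_sqr_coeff /exp_coeff /=.
  rewrite mul0r addr0 -polyC1 derivC subr0 polyC1 mulr1 hornerZ hornerX.
  rewrite !expr0 !expr1 fact0 factS fact0 mulr1.
  by field: s2.
- have n2 : n.+2%:R != 0 :> R by rewrite pnatr_eq0.
  apply: (mulfI n2); rewrite exp_quad_coeffSS IHn IHn1 hermite_polyS2.
  move: (hermite_poly nu n.+1) (hermite_poly nu n) => h1 h.
  rewrite hornerD hornerN !hornerZ hornerM hornerX.
  rewrite !factS !natrM !exprS (mulrA s) -expr2 s2.
  have n1 : n.+1%:R != 0 :> R by rewrite pnatr_eq0.
  have nf : n`!%:R != 0 :> R by rewrite pnatr_eq0 -lt0n fact_gt0.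
  move: (expf_neq0 n s0) n1 n2 nf.
  move: h1.[x] h.[x] (s ^+ n) n.+1%:R n.+2%:R n`!%:R => y z t u v w t0 u0 v0 w0.
  by field; rewrite t0 u0 v0 w0 s0.
Qed.

End generating_function.

(** * Factorization of the RBF kernel through the Segal-Bargmann kernel *)

Section kernels.
Context {R : realType}.
Implicit Types (q : quat R) (gamma nu x : R) (n : nat).

Lemma commr_real_quat q (a : R) : q * a%:A = a%:A * q.
Proof. by rewrite mulr_algr mulr_algl. Qed.

Lemma comm_scale_expr (a b : R) q m n :
  (a *: q ^+ m) * (b *: q ^+ n) = (b *: q ^+ n) * (a *: q ^+ m).
Proof.
by rewrite -!scalerAl -!scalerAr -!exprD addnC !scalerA [in LHS]mulrC.
Qed.

(** The exponent is a sum of commuting terms: a central real part and real multiples of [q^2] and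
    [q]. *)
Lemma sb_kernelE nu q x : sb_kernel nu q x =
  ((nu / pi) `^ (4^-1) * expR (- (nu / 2 * x ^+ 2))) *:
    (exp_quat (- (nu / 2) *: q ^+ 2) * exp_quat ((nu * Num.sqrt 2 * x) *: q)).
Proof.
rewrite /sb_kernel -[RHS]scalerA; congr (_ *: _).
rewrite scalerDr scalerA mulNr addrAC mulr_algr scalerA.
rewrite exp_quatD; last by rewrite commr_real_quat.
rewrite exp_quat_real mulr_algr exp_quatD//.
exact: (comm_scale_expr _ _ q 2 1).
Qed.

(** Both sides are nonnegative, so squares are compared: as [2 nu = 4 / gamma^2], the powers of
    [gamma] cancel and [sqrt (nu / pi) / (2^n n!^2)] remains. *)
Lemma rbf_norm_const gamma n : 0 < gamma -> let nu := 2 / gamma ^+ 2 in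
  Num.sqrt (2 ^+ n / (gamma ^+ (2 * n) * n`!%:R)) /
    Num.sqrt ((2 * nu) ^+ n * n`!%:R * Num.sqrt (pi / nu)) =
  (nu / pi) `^ (4^-1) / (Num.sqrt 2 ^+ n * n`!%:R).
Proof.
move=> g0 nu.
have nu0 : 0 < nu by rewrite divr_gt0// exprn_gt0.
have nuE : nu = 2 / gamma ^+ 2 by [].
clearbody nu.
have f0 : 0 < n`!%:R :> R by rewrite ltr0n fact_gt0.
have pi0 : 0 < pi :> R := pi_gt0 R.
set t := Num.sqrt (nu / pi).
have t0 : 0 < t by rewrite sqrtr_gt0 divr_gt0.
have -> : (nu / pi) `^ (4^-1) = Num.sqrt t.
  rewrite -powR12_sqrt ?ltW// /t -powR12_sqrt ?divr_ge0 ?ltW// -powRrM.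
  by congr (_ `^ _); field.
have -> : Num.sqrt (pi / nu) = t^-1 by rewrite -sqrtrV ?divr_ge0 ?ltW// invf_div.
have sq_inj (a b : R) : 0 <= a -> 0 <= b -> a ^+ 2 = b ^+ 2 -> a = b.
  by move=> a0 b0 /eqP; rewrite eqrXn2// => /eqP.
apply: sq_inj; first by rewrite divr_ge0 ?sqrtr_ge0.
  by rewrite divr_ge0 ?sqrtr_ge0// mulr_ge0 ?exprn_ge0 ?sqrtr_ge0 ?ltW.
have gn : 0 < gamma ^+ (2 * n) by rewrite exprn_gt0.
have s2n : (Num.sqrt 2 ^+ n) ^+ 2 = 2 ^+ n :> R.
  by rewrite -exprM mulnC exprM sqr_sqrtr.
have p0 : 0 <= 2 ^+ n / (gamma ^+ (2 * n) * n`!%:R).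
  by rewrite divr_ge0 ?mulr_ge0 ?exprn_ge0 ?ltW.
have q0 : 0 <= (2 * nu) ^+ n * n`!%:R * t^-1.
  by rewrite !mulr_ge0 ?invr_ge0 ?exprn_ge0 ?mulr_ge0 ?ltW.
rewrite !expr_div_n (exprMn 2) s2n !sqr_sqrtr ?(ltW t0)//.
rewrite nuE !exprMn exprVn -exprM.
move: (exprn_gt0 n (ltr0Sn R 1)) gn t0 f0.
clear p0 q0; move: (2 ^+ n) (gamma ^+ (2 * n)) t n`!%:R => a b c d a0 b0 c0 d0.
by field; rewrite !gt_eqF.
Qed.

(** Isolates a scalar and a right factor that do not depend on [n]; between them stands the general
    term of the generating function. *)
Lemma rbf_kernel_term gamma q x n : 0 < gamma -> let nu := 2 / gamma ^+ 2 in
  rbf_basis gamma n q * (normalized_hermite nu n x)%:A =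
  ((nu / pi) `^ (4^-1) * expR (- (nu / 2 * x ^+ 2))) *:
    ((exp_quad_coeff (- (nu / 2)) (nu * Num.sqrt 2 * x) n *: q ^+ n) *
     exp_quat (- (gamma ^- 2 *: q ^+ 2))).
Proof.
move=> g0 nu; have nu0 : 0 < nu by rewrite divr_gt0// exprn_gt0.
have scale2 (k c d : R) (p r : quat R) : c = k * d -> c *: (p * r) = k *: ((d *: p) * r).
  by move=> ->; rewrite -scalerAl scalerA.
rewrite mulr_algr /rbf_basis scalerA; apply: scale2.
rewrite /normalized_hermite Lnorm_hermite_fun// hermite_funE.
rewrite exp_quad_coeff_hermite mulrC mulrA mulrAC mulrA rbf_norm_const//.
by rewrite -/nu; ring.
Qed.

Lemma rbf_kernelE gamma q x : 0 < gamma -> rbf_kernel gamma q x =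
  exp_quat ((- gamma ^+ 2)^-1 *: q ^+ 2) * sb_kernel (2 / gamma ^+ 2) q x.
Proof.
move=> g0; set nu := 2 / gamma ^+ 2; apply/cvg_lim => //.
set E := exp_quat _.
have EE : exp_quat (- (gamma ^- 2 *: q ^+ 2)) = E by rewrite /E invrN scaleNr.
rewrite sb_kernelE -scalerAr.
set K := _ * expR _; set b := nu * _ * x; set a := - (nu / 2).
rewrite (_ : series _ = fun n =>
    K *: (series (fun n => exp_quad_coeff a b n *: q ^+ n) n * E)); last first.
  apply/funext => n; rewrite /series/= big_distrl/= scaler_sumr.
  apply: eq_bigr => i _; rewrite (rbf_kernel_term q x i g0) EE; reflexivity.
apply: cvg_scale_quat.
(* In the series [E] multiplies on the right, in the target on the left; it commutes with both
   exponentials, whose arguments are real multiples of powers of [q]. *)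
rewrite mulrA (exp_quatC (r := a *: q ^+ 2)); last exact: comm_scale_expr.
rewrite -mulrA (exp_quatC (r := b *: q)); last exact: (comm_scale_expr _ _ q 2 1).
rewrite mulrA; apply: cvg_mul_quat; last exact: cvg_cst.
exact: exp_quad_cvg.
Qed.

End kernels.

(** * Integration of quaternion-valued functions *)

Section quat_integration.
Context {R : realType}.
Implicit Types (f g : R -> quat R) (q : quat R).
Local Notation mu := (@lebesgue_measure R).

Lemma measurable_quat_cst q : measurable_quat (fun=> q).
Proof. by split; exact: measurable_cst. Qed.

Lemma measurable_quatD f g : measurable_quat f -> measurable_quat g ->
  measurable_quat (fun x => f x + g x).
Proof.
move=> [f1 f2 f3 f4] [g1 g2 g3 g4].
by split; [exact: (measurable_funD f1 g1)|exact: (measurable_funD f2 g2)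
  |exact: (measurable_funD f3 g3)|exact: (measurable_funD f4 g4)].
Qed.

Lemma measurable_quatM f g : measurable_quat f -> measurable_quat g ->
  measurable_quat (fun x => f x * g x).
Proof.
move=> [f1 f2 f3 f4] [g1 g2 g3 g4]; split.
- exact: (measurable_funB (measurable_funB (measurable_funB
    (measurable_funM f1 g1) (measurable_funM f2 g2))
    (measurable_funM f3 g3)) (measurable_funM f4 g4)).
- exact: (measurable_funB (measurable_funD (measurable_funD
    (measurable_funM f1 g2) (measurable_funM f2 g1))
    (measurable_funM f3 g4)) (measurable_funM f4 g3)).
- exact: (measurable_funD (measurable_funD (measurable_funB
    (measurable_funM f1 g3) (measurable_funM f2 g4))
    (measurable_funM f3 g1)) (measurable_funM f4 g2)).
- exact: (measurable_funD (measurable_funB (measurable_funD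
    (measurable_funM f1 g4) (measurable_funM f2 g3))
    (measurable_funM f3 g2)) (measurable_funM f4 g1)).
Qed.

Lemma measurable_quatZ (a : R -> R) f : measurable_fun setT a ->
  measurable_quat f -> measurable_quat (fun x => a x *: f x).
Proof.
move=> ma [f1 f2 f3 f4].
by split; [exact: (measurable_funM ma f1)|exact: (measurable_funM ma f2)
  |exact: (measurable_funM ma f3)|exact: (measurable_funM ma f4)].
Qed.

Lemma measurable_quatX f n : measurable_quat f ->
  measurable_quat (fun x => f x ^+ n).
Proof.
move=> mf; elim: n => [|n IHn]; first exact: measurable_quat_cst.
by under eq_fun do rewrite exprS; exact: measurable_quatM.
Qed.

Lemma measurable_quat_series (h : nat -> R -> quat R) n :
  (forall k, measurable_quat (h k)) ->
  measurable_quat (fun x => series (h ^~ x) n).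
Proof.
move=> mh; elim: n => [|n IHn].
  rewrite (_ : (fun _ => _) = fun=> 0); first exact: measurable_quat_cst.
  by apply/funext => x; rewrite /series /= big_geq.
by under eq_fun do rewrite seriesSr; exact: measurable_quatD.
Qed.

Lemma measurable_quat_cvg (h : nat -> R -> quat R) f :
  (forall n, measurable_quat (h n)) ->
  (forall x, h ^~ x @ \oo --> f x) -> measurable_quat f.
Proof.
move=> mh hf; split.
- apply: (@measurable_fun_cvg _ _ _ _ (fun n => qRe \o h n)) => [n|x _].
    by have [] := mh n.
  by have [] := cvg_quat_coord (hf x).
- apply: (@measurable_fun_cvg _ _ _ _ (fun n => qI \o h n)) => [n|x _].
    by have [] := mh n.
  by have [] := cvg_quat_coord (hf x).
- apply: (@measurable_fun_cvg _ _ _ _ (fun n => qJ \o h n)) => [n|x _].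
    by have [] := mh n.
  by have [] := cvg_quat_coord (hf x).
- apply: (@measurable_fun_cvg _ _ _ _ (fun n => qK \o h n)) => [n|x _].
    by have [] := mh n.
  by have [] := cvg_quat_coord (hf x).
Qed.

(** The partial sums are polynomial in [f], and measurability survives the pointwise limit. *)
Lemma measurable_exp_quat f : measurable_quat f ->
  measurable_quat (fun x => exp_quat (f x)).
Proof.
move=> mf.
apply: (@measurable_quat_cvg (fun n x => series (fun n => n`!%:R^-1 *: f x ^+ n) n)).
  move=> n; apply: measurable_quat_series => k.
  by apply: measurable_quatZ; [exact: measurable_cst|exact: measurable_quatX].
by move=> x; exact: exp_quat_cvg.
Qed.

Lemma measurable_sqr_norm_quat f : measurable_quat f ->
  measurable_fun setT (fun x => `|f x| ^+ 2).
Proof.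
move=> [f1 f2 f3 f4]; under eq_fun do rewrite sqr_norm_quat.
by do 3 (apply: measurable_funD; last exact: measurable_funX);
  exact: measurable_funX.
Qed.

Definition integrable_quat f : Prop :=
  [/\ mu.-integrable setT (EFin \o (qRe \o f)), mu.-integrable setT (EFin \o (qI \o f)),
      mu.-integrable setT (EFin \o (qJ \o f)) & mu.-integrable setT (EFin \o (qK \o f))].

(** Each coordinate of [q * f x] is such a combination of the coordinates of [f x]. *)
Lemma Rintegral_lincomb4 (a b c d : R) (f1 f2 f3 f4 : R -> R) :
  mu.-integrable setT (EFin \o f1) -> mu.-integrable setT (EFin \o f2) ->
  mu.-integrable setT (EFin \o f3) -> mu.-integrable setT (EFin \o f4) ->
  \int[mu]_x (a * f1 x + b * f2 x + c * f3 x + d * f4 x) =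
  a * (\int[mu]_x f1 x) + b * (\int[mu]_x f2 x) +
  c * (\int[mu]_x f3 x) + d * (\int[mu]_x f4 x).
Proof.
move=> i1 i2 i3 i4.
have Z k (f : R -> R) : mu.-integrable setT (EFin \o f) ->
    mu.-integrable setT (EFin \o (fun x => k * f x)).
  by move=> intf; exact: (integrableZl measurableT k intf).
have Dd (f g : R -> R) :
    mu.-integrable setT (EFin \o f) -> mu.-integrable setT (EFin \o g) ->
    mu.-integrable setT (EFin \o (fun x => f x + g x)).
  by move=> intf intg; exact: (integrableD measurableT intf intg).
have j1 := Z a _ i1; have j2 := Z b _ i2; have j3 := Z c _ i3; have j4 := Z d _ i4.
have j12 := Dd _ _ j1 j2.
by rewrite (RintegralD measurableT (Dd _ _ j12 j3) j4) (RintegralD measurableT j12 j3)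
  RintegralD// !RintegralZl.
Qed.

Lemma qintegral_mull q f : integrable_quat f ->
  qintegral (fun x => q * f x) = q * qintegral f.
Proof.
move=> [f1 f2 f3 f4]; rewrite /qintegral; congr Quat => /=.
- rewrite -(mulNr (qI q)) -(mulNr (qJ q)) -(mulNr (qK q)) -Rintegral_lincomb4//.
  by apply: eq_Rintegral => x _; rewrite !mulNr.
- rewrite [RHS](_ : _ = qI q * (\int[mu]_x qRe (f x)) + qRe q * (\int[mu]_x qI (f x))
    + - qK q * (\int[mu]_x qJ (f x)) + qJ q * (\int[mu]_x qK (f x))); last by ring.
  by rewrite -Rintegral_lincomb4//; apply: eq_Rintegral => x _; ring.
- rewrite [RHS](_ : _ = qJ q * (\int[mu]_x qRe (f x)) + qK q * (\int[mu]_x qI (f x))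
    + qRe q * (\int[mu]_x qJ (f x)) + - qI q * (\int[mu]_x qK (f x))); last by ring.
  by rewrite -Rintegral_lincomb4//; apply: eq_Rintegral => x _; ring.
- rewrite [RHS](_ : _ = qK q * (\int[mu]_x qRe (f x)) + - qJ q * (\int[mu]_x qI (f x))
    + qI q * (\int[mu]_x qJ (f x)) + qRe q * (\int[mu]_x qK (f x))); last by ring.
  by rewrite -Rintegral_lincomb4//; apply: eq_Rintegral => x _; ring.
Qed.

Lemma integrable_sqr_norm f : L2quat f ->
  mu.-integrable setT (EFin \o (fun x => `|f x| ^+ 2)).
Proof.
move=> [mf fi]; apply/integrableP; split.
  by apply/measurable_EFinP; exact: measurable_sqr_norm_quat.
under eq_integral do rewrite /= ger0_norm ?sqr_ge0//.
exact: fi.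
Qed.

(** Each coordinate of the product is at most [|f| |g|], hence at most [|f|^2 + |g|^2]. *)
Lemma integrable_quat_mul f g : L2quat f -> L2quat g ->
  integrable_quat (fun x => f x * g x).
Proof.
move=> f2 g2; have [m1 m2 m3 m4] := measurable_quatM f2.1 g2.1.
have ifg := integrableD measurableT (integrable_sqr_norm f2) (integrable_sqr_norm g2).
have le_fg c x : `|c| <= `|f x * g x| -> `|c| <= `| `|f x| ^+ 2 + `|g x| ^+ 2 |.
  move=> /le_trans; apply; rewrite norm_quatM ger0_norm ?addr_ge0 ?sqr_ge0//.
  by have : 0 <= `|f x| * `|g x| by []; move: (sqr_ge0 (`|f x| - `|g x|));
    rewrite sqrrB; move: `|f x| `|g x| => u v; nra.
split; apply: le_integrable ifg => //; try exact/measurable_EFinP;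
  move=> x _; rewrite lee_fin; apply: le_fg => /=;
  have [] := coord_le_norm_quat (f x * g x) => //.
Qed.

Lemma L2quat_sb_kernel nu q : 0 < nu -> L2quat (sb_kernel nu q).
Proof.
move=> nu0; set c := (nu / pi) `^ (4^-1).
set a := exp_quat (- (nu / 2) *: q ^+ 2).
have mk : measurable_quat (sb_kernel nu q).
  rewrite (_ : sb_kernel nu q = fun x => (c * expR (- (nu / 2 * x ^+ 2))) *:
      (a * exp_quat ((nu * Num.sqrt 2 * x) *: q))); last first.
    by apply/funext => x; rewrite sb_kernelE.
  apply: measurable_quatZ.
    apply: measurable_funM => //; apply: measurableT_comp => //.
    apply: measurable_funN => //; apply: measurable_funM => //.
  apply: measurable_quatM; first exact: measurable_quat_cst.
  apply: measurable_exp_quat; apply: measurable_quatZ; last exact: measurable_quat_cst.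
  exact: measurable_funM.
split => //.
(* The constant comes from completing a square: twice [- nu y^2 / 2 + nu sqrt 2 y r] equals
   [4 nu r^2 - nu y^2 / 2] minus [(nu / 2) (y - 2 sqrt 2 r)^2], with [y = |x|] and [r = |q|]. *)
pose C := (c * `|a|) ^+ 2 * expR (4 * nu * `|q| ^+ 2).
have C0 : 0 <= C by rewrite mulr_ge0 ?sqr_ge0 ?expR_ge0.
have nu20 : 0 < nu / 2 by rewrite divr_gt0.
have kC x : `|sb_kernel nu q x| ^+ 2 <= C * gaussian (nu / 2) x.
  apply: (@le_trans _ _ ((c * `|a|) ^+ 2 *
      (expR (- (nu / 2 * x ^+ 2)) * expR (nu * Num.sqrt 2 * (`|x| * `|q|))) ^+ 2)).
    rewrite -exprMn ler_pXn2r ?nnegrE ?mulr_ge0 ?powR_ge0 ?expR_ge0//.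
    rewrite sb_kernelE normrZ norm_quatM ger0_norm; last first.
      by rewrite mulr_ge0 ?powR_ge0 ?expR_ge0.
    rewrite -/a -/c mulrACA ler_wpM2l ?mulr_ge0 ?powR_ge0//.
    rewrite ler_wpM2l ?expR_ge0// (le_trans (norm_exp_quat_le _))// ler_expR.
    by rewrite normrZ !normrM (ger0_norm (ltW nu0)) ger0_norm ?sqrtr_ge0// -!mulrA.
  rewrite /C /gaussian -[leRHS]mulrA ler_wpM2l ?sqr_ge0// -!expRD -expRM_natl ler_expR.
  have s2 : Num.sqrt 2 ^+ 2 = 2 :> R by rewrite sqr_sqrtr.
  rewrite -(real_normK (num_real x)).
  have amgm (y r s : R) : s ^+ 2 = 2 ->
      2 * (- (nu / 2 * y ^+ 2) + nu * s * (y * r)) <=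
      4 * nu * r ^+ 2 - nu / 2 * y ^+ 2.
    move=> ss.
    have -> : 4 * nu * r ^+ 2 - nu / 2 * y ^+ 2 =
        2 * (- (nu / 2 * y ^+ 2) + nu * s * (y * r)) +
        nu / 2 * (y - 2 * s * r) ^+ 2 by field: ss.
    by rewrite lerDl mulr_ge0 ?sqr_ge0// ltW.
  exact: amgm.
apply: (@le_lt_trans _ _ (\int[mu]_x (C%:E * (gaussian (nu / 2) x)%:E))%E).
  apply: ge0_le_integral => //.
  - by apply/measurable_EFinP; exact: measurable_sqr_norm_quat.
  - have /integrableP[] := integrableZl measurableT C (integrable_gaussian nu20).
    by [].
  - by move=> x _; rewrite lee_fin.
have /integrableP[_] := integrableZl measurableT C (integrable_gaussian nu20).
under eq_integral do rewrite gee0_abs ?mule_ge0 ?lee_fin ?expR_ge0//.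
by [].
Qed.

End quat_integration.

(** * From the kernels to the transforms *)

Theorem corollary2p17 (R : realType) (gamma : R) (psi : R -> quat R)
    (gamma_gt0 : 0 < gamma) (psi_L2 : L2quat psi) :
  forall q : quat R,
    rbf_transform gamma psi q =
    expmul (- gamma ^+ 2) (sb_transform (2 / gamma ^+ 2) psi) q.
Proof.
(* The left factor goes under the integral, since a product of two square integrable functions is
   integrable; the integrands then agree pointwise. *)
move=> q; rewrite /expmul /sb_transform -qintegral_mull; last first.
  apply: integrable_quat_mul => //; apply: L2quat_sb_kernel.
  by rewrite divr_gt0// exprn_gt0.
congr qintegral; apply/funext => x.
by rewrite rbf_kernelE// mulrA.
Qed.
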